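(* Let $P$ be the set of centers of tiles of one of the regular tilings $\mathcal{T}\in\{(4^4),(6^3),(3^6)\}$ (positioned as in the context), let $\varphi_\alpha(z)=\exp(2\pi i z/\alpha)$ with $\alpha$ admissible for $\mathcal{T}$, let $\mathcal{S}_\alpha=\{\varphi_\alpha(T): T\in\mathcal{T}\}$ and $Q_\alpha=\{\varphi_\alpha(t): t\in P\}$, and let $\mathcal{C}_P$ be the coloring of $P$ induced by a nonzero ideal $(\beta)$ of $\mathbb{Z}[\xi]$ and compatible with $\varphi_\alpha$. (a) The elements of $\mathrm{R}(\mathcal{S}_\alpha)$ are color symmetries of the coloring $\varphi_\alpha(\mathcal{C}_P)$ of $Q_\alpha$. (b) If $\alpha$ and $\beta$ are balanced, then the elements of $\mathrm{S}(\mathcal{S}_\alpha)$ are color symmetries of $\varphi_\alpha(\mathcal{C}_P)$.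
   Context: The plane is identified with $\mathbb{C}$, $\mathbb{C}^*=\mathbb{C}\setminus\{0\}$, $i=\sqrt{-1}$, $\omega=e^{2\pi i/3}$. The regular tilings are positioned as follows; $P$ is the set of centers of the tiles and $\Lambda$ the orbit of $0$ under the group of translations preserving $\mathcal{T}$. $(4^4)$: unit squares with $P=\mathbb{Z}[i]$; $\Lambda=\mathbb{Z}[i]$. $(6^3)$: regular hexagons with $P=\mathbb{Z}[\omega]$; $\Lambda=\mathbb{Z}[\omega]$. $(3^6)$: equilateral triangles whose set of vertices is the ideal $P_0=(2+\omega)$ of $\mathbb{Z}[\omega]$ (side length $\sqrt3$); $P=\mathbb{Z}[\omega]\setminus P_0$ and $\Lambda=P_0$. Put $\xi=i$ for $(4^4)$ and $\xi=\omega$ for $(6^3)$ and $(3^6)$. A number $\alpha\in\mathbb{C}^*$ is admissible for $\mathcal{T}$ if $\alpha\in\Lambda$ and $|\alpha|>\max\{|z_1-z_2| : z_1,z_2\in\partial T,\ T\in\mathcal{T}\}$; in that case $\mathcal{S}_\alpha$ is a tiling of $\mathbb{C}^*$. An element of $\mathbb{Z}[\xi]$ is balanced if it and its complex conjugate are associates in $\mathbb{Z}[\xi]$. For a set $X$ of points or tiles, $\mathrm{S}(X)$ is the group of isometries of the plane mapping $X$ onto itself, and $\mathrm{R}(X)$ is its subgroup of direct (orientation-preserving) isometries. One has $\mathrm{S}(\mathcal{S}_\alpha)\subseteq\mathrm{S}(Q_\alpha)$. A coloring of a set $X$ is a surjective map $\mathcal{C}_X:X\to K$ onto a finite set $K$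 of colors, equivalently a partition of $X$ into finitely many nonempty classes. A color symmetry of $\mathcal{C}_X$ is an $h\in\mathrm{S}(X)$ for which there is a permutation $\sigma_h$ of $K$ with $\mathcal{C}_X(h(x))=\sigma_h(\mathcal{C}_X(x))$ for all $x\in X$. A sublattice of $\mathbb{Z}[\xi]$ is a subgroup of finite index; the coloring of $\mathbb{Z}[\xi]$ induced by a sublattice $\Gamma$ is the partition $\{X_i\}_{i=1}^m$ into cosets of $\Gamma$, and the coloring of $P$ induced by $\Gamma$ is $\{X_i\cap P: X_i\cap P\ne\varnothing\}$. A coloring $\{Y_j\}$ of $P$ is compatible with $\varphi_\alpha$ if $\{\varphi_\alpha(Y_j)\}$ is a coloring of $Q_\alpha$ in the sense that each point receives exactly one color, i.e. $\varphi_\alpha(Y_j)\cap\varphi_\alpha(Y_k)=\varnothing$ for $j\neq k$; the resulting coloring of $Q_\alpha$ is denoted $\varphi_\alpha(\mathcal{C}_P)$. *)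

(* Defs.v *)
From HB Require Import structures.
From mathcomp Require Import all_boot all_order all_algebra.
From mathcomp Require Import all_classical all_reals all_analysis.
From mathcomp Require Import complex.
Set Implicit Arguments.
Unset Strict Implicit.
Unset Printing Implicit Defensive.
Import Order.TTheory GRing.Theory Num.Theory.
Import numFieldNormedType.Exports.
Local Open Scope classical_set_scope.
Local Open Scope complex_scope.
Local Open Scope ring_scope.

(* The plane is R[i].  In R[i] the order is the partial order of a
   numClosedFieldType and `|z| is the modulus, seen as an element of R[i]. *)

Section Plane.
Variable R : realType.
Local Notation C := R[i].
Implicit Types (x y z a b c v : C) (A X Y Gamma : set C) (h : C -> C).

Definition cexp z : C :=
  (expR (complex.Re z))%:C * (cos (complex.Im z) +i* sin (complex.Im z)).

Definition imagi : C := 0 +i* 1.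

(* exp (2 pi i / n) *)
Definition zeta (n : nat) : C := cexp ((2 * pi)%:C * imagi / n%:R).

Definition omega : C := zeta 3.

(* The regular n-gon with center c having v as a vertex, as a closed region:
   the convex hull of the points c + (v - c) * zeta n ^+ k. *)
Definition ngon (n : nat) c v : set C :=
  [set z | exists w : 'I_n -> R,
    [/\ forall k, 0 <= w k,
        \sum_(k < n) w k = 1
      & z = \sum_(k < n) (w k)%:C * (c + (v - c) * zeta n ^+ k)]].

Definition boundary A : set C :=
  closure (A : set C^o) `\` interior (A : set C^o).

(* Z[xi], for a quadratic integer xi. *)
Definition Zadj (xi : C) : set C :=
  [set z | exists m n : int, z = m%:~R + n%:~R * xi].

Definition principal (xi b : C) : set C := [set b * z | z in Zadj xi].

Definition Zunit (xi u : C) : Prop :=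
  Zadj xi u /\ exists2 v, Zadj xi v & u * v = 1.

Definition associates (xi a b : C) : Prop := exists2 u, Zunit xi u & b = u * a.

Definition balanced (xi z : C) : Prop := Zadj xi z /\ associates xi z (conjc z).

Definition isometry h : Prop := forall x y, `|h x - h y| = `|x - y|.

(* Twice the signed area of the triangle x, y, z. *)
Definition signed_area x y z : R := complex.Im (conjc (y - x) * (z - x)).

Definition orientation_preserving h : Prop :=
  forall x y z, 0 < signed_area x y z -> 0 < signed_area (h x) (h y) (h z).

Definition sym_points X : set (C -> C) :=
  [set h | isometry h /\ h @` X = X].

Definition sym_tiles (S : set (set C)) : set (C -> C) :=
  [set h | isometry h /\ [set h @` A | A in S] = S].

Definition rot_tiles (S : set (set C)) : set (C -> C) :=
  [set h | sym_tiles S h /\ orientation_preserving h].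

(* A coloring is given by its set of color classes; the colors are the classes
   themselves. *)
Definition is_coloring X (K : set (set C)) : Prop :=
  finite_set K /\ partition K id X.

Definition color_symmetry X (K : set (set C)) h : Prop :=
  [/\ is_coloring X K, sym_points X h
    & exists2 sigma : set C -> set C, set_bij K K sigma
      & forall Y x, K Y -> Y x -> sigma Y (h x)].

Definition cosets (xi : C) Gamma : set (set C) :=
  [set [set x + g | g in Gamma] | x in Zadj xi].

Definition induced_coloring (xi : C) Gamma (P : set C) : set (set C) :=
  [set Y | Y !=set0 /\ exists2 X, cosets xi Gamma X & Y = X `&` P].

End Plane.

Arguments omega {R}.
Arguments imagi {R}.

(* Named by vertex configuration: squares, hexagons, triangles. *)
Inductive regular_tiling := T44 | T63 | T36.

Section Tilings.
Variables (R : realType) (T : regular_tiling).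
Local Notation C := R[i].
Implicit Types (z c v : C).

Definition xi : C := match T with T44 => imagi | T63 | T36 => omega end.

Definition sides : nat := match T with T44 => 4 | T63 => 6 | T36 => 3 end.

Definition centers : set C :=
  match T with
  | T44 | T63 => Zadj xi
  | T36 => Zadj xi `\` principal xi (2 + omega)
  end.

(* v is a vertex of the tile centered at c.  For squares and hexagons one vertex
   per tile is singled out: it gives axis-parallel unit squares, and hexagons
   with inradius 1/2, two of whose sides are vertical.  The triangles have
   circumradius 1, hence side sqrt 3. *)
Definition tile_vertex c v : Prop :=
  match T with
  | T44 => v = c + (1 + imagi) / 2
  | T63 => v = c + (2 + omega) / 3
  | T36 => principal xi (2 + omega) v /\ `|v - c| = 1
  end.

Definition tiling : set (set C) :=
  [set A | exists c v, [/\ centers c, tile_vertex c v & A = ngon sides c v]].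

(* The orbit of 0 under the group of translations preserving the tiling. *)
Definition Lambda : set C :=
  [set s | [set [set z + s | z in A] | A in tiling] = tiling].

Definition admissible (alpha : C) : Prop :=
  [/\ alpha != 0, Lambda alpha
    & forall A z1 z2, tiling A -> boundary A z1 -> boundary A z2 ->
        `|z1 - z2| < `|alpha| ].

Definition phi (alpha z : C) : C := cexp ((2 * pi)%:C * imagi * z / alpha).

Definition S_ (alpha : C) : set (set C) := [set phi alpha @` A | A in tiling].

Definition Q_ (alpha : C) : set C := phi alpha @` centers.

(* Distinct classes have disjoint images. *)
Definition compatible (alpha : C) (K : set (set C)) : Prop :=
  trivIset K (fun Y => phi alpha @` Y).

Definition image_coloring (alpha : C) (K : set (set C)) : set (set C) :=
  [set phi alpha @` Y | Y in K].

Definition ideal_coloring (beta : C) : set (set C) :=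
  induced_coloring xi (principal xi beta) centers.

End Tilings.

Arguments phi {R} alpha z.
Arguments centers {R} T.
Arguments tiling {R} T.

(* Main.v *)
Require Import Defs.
From mathcomp Require Import all_boot all_order all_algebra.
From mathcomp Require Import all_classical all_reals all_analysis.
From mathcomp Require Import complex ring lra zify.
Set Implicit Arguments.
Unset Strict Implicit.
Unset Printing Implicit Defensive.
Import Order.TTheory GRing.Theory Num.Theory.
Import numFieldNormedType.Exports.
Local Open Scope classical_set_scope.
Local Open Scope complex_scope.
Local Open Scope ring_scope.

(* Lifting through [phi].  A symmetry [h] of [S_ alpha] fixes [0]: the tiles
   accumulate in arbitrarily small size at [0] only.  Hence [h] is
   [z |-> u * z] or [z |-> u * conjc z] with [`|u| = 1], and
   [h (phi z) = phi (H z + t)] where [H] is the identity or, in the second case,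
   [z |-> - (alpha / conjc alpha) * conjc z].  Since tiles have diameter smaller
   than [`|alpha|], the preimage under [phi] of the image of a tile splits into
   separated translates by multiples of [alpha], so after changing [t] by such a
   multiple [z |-> H z + t] maps a tile onto a tile.  Comparing centers (and
   vertices for the triangles) puts [t] in the translation lattice, and then
   [z |-> H z + t] permutes the centers and the cosets of the ideal: for
   [H = id] always, for the reflection because [alpha / conjc alpha] is a unit
   and [(beta)] is stable under conjugation when both are balanced. *)

Local Notation isometry := Defs.isometry.
Local Arguments omega {R} : simpl never.
Local Arguments imagi {R} : simpl never.
Local Arguments cexp : simpl never.

(** * The complex exponential and its kernel *)

Section Exponential.
Variable R : realType.
Local Notation C := R[i].
Implicit Types (z w : C).

Lemma complex_ext z w :
  complex.Re z = complex.Re w -> complex.Im z = complex.Im w -> z = w.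
Proof. by case: z w => [a b] [c d] /= -> ->. Qed.

Lemma Im_addc z w : complex.Im (z + w) = complex.Im z + complex.Im w.
Proof. by case: z w => [a b] [c d]. Qed.

Lemma Im_oppc z : complex.Im (- z) = - complex.Im z.
Proof. by case: z. Qed.

Lemma Im_mulc z w :
  complex.Im (z * w) = complex.Re z * complex.Im w + complex.Im z * complex.Re w.
Proof. by case: z w => [a b] [c d]. Qed.

Lemma conjcD z w : conjc (z + w) = conjc z + conjc w.
Proof. exact: rmorphD. Qed.

Lemma conjcN z : conjc (- z) = - conjc z.
Proof. exact: rmorphN. Qed.

Lemma conjcM z w : conjc (z * w) = conjc z * conjc w.
Proof. exact: rmorphM. Qed.

Lemma cexpD z w : cexp (z + w) = cexp z * cexp w.
Proof.
case: z w => [a b] [c d]; rewrite /cexp /=; simpc; rewrite expRD cosD sinD.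
by congr (_ +i* _); ring.
Qed.

Lemma cexp0 : cexp 0 = 1 :> C.
Proof. by rewrite /cexp /= expR0 cos0 sin0 mul1r. Qed.

Lemma conj_cexp z : conjc (cexp z) = cexp (conjc z).
Proof.
case: z => [a b]; rewrite /cexp /=; simpc; rewrite cosN sinN.
by congr (_ +i* _); ring.
Qed.

Lemma norm_cexp z : `|cexp z| = (expR (complex.Re z))%:C.
Proof.
rewrite normrM [X in _ * X]normc_def /= cos2Dsin2 sqrtr1 mulr1.
by rewrite ger0_norm // lecR expR_ge0.
Qed.

Lemma cexp_neq0 z : cexp z != 0.
Proof.
by rewrite -normr_eq0 norm_cexp eq_complex /= negb_and gt_eqF ?expR_gt0.
Qed.

Lemma cexpX z n : cexp z ^+ n = cexp (n%:R * z).
Proof.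
elim: n => [|n IH]; first by rewrite mul0r cexp0.
by rewrite exprS IH -cexpD -natr1; congr cexp; ring.
Qed.

(** The double-angle formula gives [sin (x / 2) = 0]. Subtracting [k] times [pi] brings [x / 2] into
    [[0, pi)], where the sine vanishes only at [0]. *)
Lemma cos_eq1 (x : R) : cos x = 1 -> exists k : int, x = 2 * pi * k%:~R.
Proof.
have p0 := pi_gt0 R; have tp0 : 0 < 2 * pi :> R by rewrite mulr_gt0.
move=> cx1; have : sin (x / 2) = 0.
  have := cos_mulr2n (x / 2); rewrite (_ : x / 2 *+ 2 = x); last by field.
  by rewrite cx1 cos2sin2 => /eqP h; apply/eqP; rewrite -sqrf_eq0; apply/eqP; lra.
move=> sx; pose k := Num.floor (x / (2 * pi)); exists k.
have /andP[] := floor_itv (x / (2 * pi)); rewrite -/k intrD1.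
rewrite ler_pdivlMr // ltr_pdivrMr // => h1 h2.
have sin0k (j : int) (y : R) : sin y = 0 -> sin (y + pi * j%:~R) = 0.
  move=> y0; have sn (n : nat) (z : R) : sin z = 0 -> sin (z + pi * n%:R) = 0.
    elim: n z => [|n IH] z z0; first by rewrite mulr0 addr0.
    rewrite -natr1 mulrDr mulr1 addrA sinDpi IH ?oppr0 //.
  case: j => n; first exact: sn.
  apply: oppr_inj; rewrite -sinN oppr0 opprD NegzE mulrNz mulrN opprK.
  by apply: sn; rewrite sinN y0 oppr0.
have := sin0k (- k) _ sx; rewrite mulrNz mulrN => s0.
apply/eqP; apply: contraT => xk; exfalso.
have xk' : 2 * pi * k%:~R < x by rewrite lt_neqAle eq_sym xk mulrC.
have : 0 < sin (x / 2 - pi * k%:~R) by apply: sin_gt0_pi; lra.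
by rewrite s0 ltxx.
Qed.

Lemma twopii_neq0 : (2 * pi)%:C * imagi != 0 :> C.
Proof.
apply: mulf_neq0; rewrite eq_complex /= negb_and ?oner_eq0 ?orbT //.
by rewrite gt_eqF // mulr_gt0 // pi_gt0.
Qed.

(** Taking moduli kills the real part of [z]; then the cosine of the imaginary part is [1]. *)
Lemma cexp_eq1 z : cexp z = 1 -> exists k : int, z = (2 * pi)%:C * imagi * k%:~R.
Proof.
move=> e1; have := norm_cexp z; rewrite e1 normr1 => /eqP.
rewrite eq_complex /= eqxx andbT -expR0 => /eqP /expR_inj re0.
have := congr1 (@complex.Re R) e1; rewrite /cexp -re0 expR0 mul1r /=.
move=> /cos_eq1[k hk]; exists k; apply: complex_ext.
  by rewrite -re0 -(rmorph_int (real_complex R) k) /imagi /=; simpc.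
by rewrite hk -(rmorph_int (real_complex R) k) /imagi /=; simpc.
Qed.

Lemma cexp_int (k : int) : cexp ((2 * pi)%:C * imagi * k%:~R) = 1 :> C.
Proof.
have e1 : cexp ((2 * pi)%:C * imagi) = 1 :> C.
  have -> : (2 * pi)%:C * imagi = (pi *+ 2) *i :> C.
    by rewrite /imagi; simpc; rewrite mulr_natl.
  by rewrite /cexp /= expR0 cos2pi sin2pi; simpc.
have en (n : nat) : cexp ((2 * pi)%:C * imagi * n%:R) = 1 :> C.
  by rewrite mulrC -cexpX e1 expr1n.
case: k => n; first exact: en.
pose c : C := (2 * pi)%:C * imagi.
have := cexpD (c * (Negz n)%:~R) (c * n.+1%:R).
by rewrite NegzE mulrNz mulrN addNr cexp0 en mulr1.
Qed.

End Exponential.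

(** * The covering map [phi] and its period [alpha] *)

Section Phi.
Variables (R : realType) (alpha : R[i]).
Hypothesis alpha0 : alpha != 0.
Local Notation C := R[i].
Local Notation phi := (phi alpha).
Implicit Types (z w u : C).

Lemma phiD z w : phi (z + w) = phi z * phi w.
Proof. by rewrite /Defs.phi mulrDr mulrDl cexpD. Qed.

Lemma phi_neq0 z : phi z != 0.
Proof. exact: cexp_neq0. Qed.

Lemma phi_period (k : int) : phi (k%:~R * alpha) = 1.
Proof. by rewrite /Defs.phi -mulrA mulfK // cexp_int. Qed.

Lemma phi_eq1 z : phi z = 1 -> exists k : int, z = k%:~R * alpha.
Proof.
move=> /cexp_eq1[k hk]; exists k.
have pi0 := twopii_neq0 R.
by apply: (mulfI pi0); rewrite [RHS]mulrA -hk divfK.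
Qed.

Lemma phi_eq z w : phi z = phi w -> exists k : int, z = w + k%:~R * alpha.
Proof.
move=> e; have [|k hk] := @phi_eq1 (z - w); last by exists k; rewrite -hk addrC subrK.
by apply: (mulIf (phi_neq0 w)); rewrite -phiD subrK mul1r.
Qed.

Lemma phi_shift z (k : int) : phi (z + k%:~R * alpha) = phi z.
Proof. by rewrite phiD phi_period mulr1. Qed.

(** With [p] and [q] the coordinates of [u], [acos p], negated when [q < 0], is an argument of [u].
    Scaled by [alpha / (2 pi)] it becomes a preimage of [u], so a rotation about [0] lifts to a
    translation. *)
Lemma unit_phi u : `|u| = 1 -> exists t, u = phi t.
Proof.
case: u => p q /eqP; rewrite -(@eqrXn2 _ 2) // -add_Re2_Im2 /= expr1n.
rewrite eq_complex /= eqxx andbT => /eqP pq.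
have p1 : -1 <= p <= 1 by apply/andP; nra.
have [t [ct st]] : exists t : R, p = cos t /\ q = sin t.
  have [q0|q0] := leP 0 q.
    exists (acos p); rewrite acosK ?in_itv //= sin_acos //; split=> //.
    by rewrite -pq addrC addKr sqrtr_sqr ger0_norm.
  exists (- acos p); rewrite cosN sinN acosK ?in_itv //= sin_acos //; split=> //.
  by rewrite -pq addrC addKr sqrtr_sqr ltr0_norm // opprK.
exists (alpha * (t / (2 * pi))%:C); rewrite /Defs.phi.
have -> : (2 * pi)%:C * imagi * (alpha * (t / (2 * pi))%:C) / alpha = t *i :> C.
  rewrite mulrCA [X in X / _]mulrC mulfK // mulrAC -rmorphM.
  have pi2 : 2 * pi != 0 :> R by rewrite gt_eqF // mulr_gt0 // pi_gt0.
  by rewrite -[(2 * pi) * _]mulrC divfK // /imagi; simpc.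
by rewrite /cexp /= expR0 ct st; simpc.
Qed.

(** Conjugation changes the sign of [i] in the exponent and the denominator to [conjc alpha];
    restoring the denominator [alpha] produces the factor [- (alpha / conjc alpha)]. *)
Lemma conj_phi z : conjc (phi z) = phi (- (alpha / conjc alpha) * conjc z).
Proof.
have ca0 : conjc alpha != 0 by rewrite conjc_eq0.
have ci : conjc imagi = - imagi :> C by rewrite /imagi; simpc.
rewrite /Defs.phi conj_cexp; congr cexp.
rewrite !conjcM conjc_inv ci conjc_real; move: (_%:C) imagi => c d; field; exact/andP.
Qed.

Lemma norm_phi z :
  `|phi z| = (expR (- (2 * pi) * complex.Im (z / alpha)))%:C.
Proof.
rewrite norm_cexp -2!mulrA; congr (expR _)%:C.
by rewrite /imagi mulrA; case: (z / alpha) => a b; simpc.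
Qed.

End Phi.

(** * Isometries of the plane fixing the origin *)

Section Isometries.
Variable R : realType.
Local Notation C := R[i].
Implicit Types (z w u : C) (h : C -> C).

Lemma isometry_inj h : isometry h -> injective h.
Proof.
move=> hi x y e; apply/eqP; rewrite -subr_eq0 -normr_eq0 -hi e subrr normr0 //.
Qed.

Lemma eq_norm_sqr z w : `|z| = `|w| ->
  complex.Re z ^+ 2 + complex.Im z ^+ 2 = complex.Re w ^+ 2 + complex.Im w ^+ 2.
Proof.
by move=> e; apply: complexI; rewrite !add_Re2_Im2 e.
Qed.

(** Preserving the distances to [0], [1] and [i] means preserving inner products: [h 1] and [h i]
    form an orthonormal frame, in which [h z] has the coordinates of [z]. *)
Lemma isometry_fix0 h : isometry h -> h 0 = 0 ->
  exists2 u, `|u| = 1 &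
    (forall z, h z = u * z) \/ (forall z, h z = u * conjc z).
Proof.
move=> hi h0; have nh z : `|h z| = `|z| by have := hi z 0; rewrite h0 !subr0.
exists (h 1); first by rewrite nh normr1.
have := eq_norm_sqr (nh 1); have := eq_norm_sqr (nh 'i%C).
have := eq_norm_sqr (hi 'i%C 1).
case e1: (h 1) => [p q]; case ei: (h 'i%C) => [m n].
(* [e] is the determinant of the frame: [1] for a rotation, [-1] for a reflection. *)
rewrite /= => k1 k2 k3; pose e := n * p - m * q.
have pq : p ^+ 2 + q ^+ 2 = 1 by lra.
have mn : m ^+ 2 + n ^+ 2 = 1 by lra.
have o : m * p + n * q = 0 by lra.
have em : m = - q * e.
  have := congr1 ( *%R m) pq; have := congr1 ( *%R p) o; rewrite /e; lra.
have en : n = p * e.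
  have := congr1 ( *%R n) pq; have := congr1 ( *%R q) o; rewrite /e; lra.
have ee : e ^+ 2 = 1.
  have := congr1 ( *%R (m * p + n * q)) o; have : (m ^+ 2 + n ^+ 2) * (p ^+ 2 + q ^+ 2) = 1.
    by rewrite mn pq mulr1.
  rewrite /e; lra.
have hz (a b : R) : h (a +i* b) = (p * a - q * b * e) +i* (q * a + p * b * e).
  have := eq_norm_sqr (nh (a +i* b)); have := eq_norm_sqr (hi (a +i* b) 'i%C).
  have := eq_norm_sqr (hi (a +i* b) 1); rewrite e1 ei.
  case: (h _) => [r s] /= l1 l2 l3.
  have ra : r * p + s * q = a by lra.
  have rb : e * (s * p - r * q) = b by rewrite em en in l2; rewrite em en in mn; lra.
  have sp : s * p - r * q = e * b by rewrite -rb mulrA -expr2 ee mul1r.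
  congr (_ +i* _).
    have := congr1 ( *%R r) pq; have := congr1 ( *%R p) ra; have := congr1 ( *%R q) sp.
    lra.
  have := congr1 ( *%R s) pq; have := congr1 ( *%R q) ra; have := congr1 ( *%R p) sp.
  lra.
have /orP[/eqP e_1|/eqP e_1] : (e == 1) || (e == -1) by rewrite -sqrf_eq1 ee.
  by left=> -[a b]; rewrite hz e_1; simpc; congr (_ +i* _); ring.
by right=> -[a b]; rewrite hz e_1; simpc; congr (_ +i* _); ring.
Qed.

End Isometries.

(** * Roots of unity and the arithmetic of [omega] *)

Section RootsOfUnity.
Variable R : realType.
Local Notation C := R[i].

Lemma zetaX n : (0 < n)%N -> zeta R n ^+ n = 1.
Proof.
move=> n0; rewrite cexpX mulrC divfK ?pnatr_eq0 -?lt0n //.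
by have := cexp_int R 1; rewrite mulr1.
Qed.

Lemma norm_zeta n : (0 < n)%N -> `|zeta R n| = 1.
Proof.
move=> n0; apply/eqP; rewrite -(@pexpr_eq1 _ _ n) //.
by rewrite -normrX zetaX // normr1.
Qed.

(** Otherwise [1 / n] would be an integer. *)
Lemma zeta_neq1 n : (1 < n)%N -> zeta R n != 1.
Proof.
move=> n1; apply/eqP => /cexp_eq1[k].
have pi0 := twopii_neq0 R.
move=> /(mulfI pi0) e.
have n0 : n%:R != 0 :> C by rewrite pnatr_eq0 -lt0n ltnW.
have : (k * n%:Z)%:~R == 1%:~R :> C by rewrite intrM -e mulVf.
rewrite eqr_int => /eqP h; have : (n%:Z %| 1)%Z by apply/dvdzP; exists k.
by rewrite dvdz1 absz_nat => /eqP n_1; rewrite n_1 in n1.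
Qed.

Lemma sum_zeta n : (1 < n)%N -> \sum_(k < n) zeta R n ^+ k = 0.
Proof.
move=> n1; apply: (mulfI (_ : zeta R n - 1 != 0)).
  by rewrite subr_eq0 zeta_neq1.
by rewrite -subrX1 zetaX ?subrr ?mulr0 // ltnW.
Qed.

Lemma omega2 : omega ^+ 2 = - 1 - omega :> C.
Proof.
have := @sum_zeta 3 isT; rewrite !big_ord_recl big_ord0 /= expr0 addr0 expr1.
rewrite /bump /= -/omega => /eqP; rewrite addrA addrC addr_eq0 => /eqP ->.
by rewrite opprD.
Qed.

Lemma conj_norm1 (z : C) : `|z| = 1 -> z * conjc z = 1.
Proof. by move=> z1; rewrite -sqr_normc z1 expr1n. Qed.

Lemma conj_omega : conjc omega = -1 - omega :> C.
Proof.
have w0 : omega != 0 :> C by rewrite cexp_neq0.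
apply: (mulfI w0); rewrite conj_norm1 ?norm_zeta //.
by rewrite mulrBr -expr2 omega2; ring.
Qed.

(** A real [omega] would equal its conjugate, which is both its inverse and its square; this forces
    [omega = 1]. *)
Lemma Im_omega : complex.Im (omega : C) != 0.
Proof.
apply/eqP => i0; have /eqP := zeta_neq1 (isT : (1 < 3)%N); apply.
have rw : conjc omega = omega :> C.
  by move: i0; case: (omega : C) => a b /= ->; rewrite oppr0.
have := conj_norm1 (norm_zeta (isT : (0 < 3)%N)).
rewrite -/omega rw -expr2 omega2 -conj_omega rw //.
Qed.

End RootsOfUnity.

(** * The ring [Z[xi]] and its principal ideals *)

Section Lattice.
Variables (R : realType) (T : regular_tiling).
Local Notation C := R[i].
Local Notation xi := (xi R T).
Local Notation Z := (Zadj xi).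
Implicit Types (x y z b : C) (m n : int).

(** [xi] is a root of [x^2 - k x + 1], with [k = 0] for [i] and [k = -1] for [omega]. These facts
    allow one argument for both rings. *)
Lemma xiP : exists k : int, [/\ xi ^+ 2 = -1 + k%:~R * xi,
  conjc xi = k%:~R - xi & complex.Im xi != 0].
Proof.
rewrite /Defs.xi; case: T.
- exists 0; rewrite mul0r addr0 sub0r sqr_i; split=> //; last exact: oner_neq0.
  by rewrite /imagi; simpc.
- exists (-1); rewrite omega2 conj_omega mulN1r; split=> //; exact: Im_omega.
- exists (-1); rewrite omega2 conj_omega mulN1r; split=> //; exact: Im_omega.
Qed.

Lemma Zadj_int m : Z m%:~R.
Proof. by exists m, 0; rewrite mul0r addr0. Qed.

Lemma Zadj1 : Z 1. Proof. exact: (Zadj_int 1). Qed.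

Lemma Zadj_xi : Z xi.
Proof. by exists 0, 1; rewrite mul1r add0r. Qed.

Lemma ZadjD x y : Z x -> Z y -> Z (x + y).
Proof.
move=> [m [n ->]] [p [q ->]]; exists (m + p), (n + q).
by rewrite !intrD; ring.
Qed.

Lemma ZadjN x : Z x -> Z (- x).
Proof. by move=> [m [n ->]]; exists (- m), (- n); rewrite !mulrNz; ring. Qed.

Lemma ZadjB x y : Z x -> Z y -> Z (x - y).
Proof. by move=> hx hy; apply: ZadjD => //; apply: ZadjN. Qed.

Lemma ZadjM x y : Z x -> Z y -> Z (x * y).
Proof.
have [k [sq _ _]] := xiP.
move=> [m [n ->]] [p [q ->]]; exists (m * p - n * q), (m * q + n * p + n * q * k).
rewrite !(intrD, intrM, mulrNz).
transitivity (m%:~R * p%:~R + (m%:~R * q%:~R + n%:~R * p%:~R) * xi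
  + n%:~R * q%:~R * xi ^+ 2); first by ring.
by rewrite sq; ring.
Qed.

Lemma conjc_int m : conjc (m%:~R) = m%:~R :> C.
Proof. exact: rmorph_int. Qed.

Lemma Zadj_conj x : Z x -> Z (conjc x).
Proof.
have [k [_ cj _]] := xiP.
move=> [m [n ->]]; exists (m + n * k), (- n).
rewrite conjcD conjcM !conjc_int cj intrD intrM mulrNz; ring.
Qed.

Lemma principalD b x y : principal xi b x -> principal xi b y -> principal xi b (x + y).
Proof.
by move=> [p hp <-] [q hq <-]; exists (p + q); [exact: ZadjD|rewrite mulrDr].
Qed.

Lemma principalN b x : principal xi b x -> principal xi b (- x).
Proof. by move=> [p hp <-]; exists (- p); [exact: ZadjN|rewrite mulrN]. Qed.

Lemma principalB b x y : principal xi b x -> principal xi b y -> principal xi b (x - y).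
Proof. by move=> hx hy; apply: principalD => //; apply: principalN. Qed.

Lemma principalM b x y : principal xi b x -> Z y -> principal xi b (x * y).
Proof. by move=> [p hp <-] hy; exists (p * y); [exact: ZadjM|rewrite mulrA]. Qed.

Lemma principal_gen b : principal xi b b.
Proof. by exists 1; [exact: Zadj1|rewrite mulr1]. Qed.

Lemma principal_Zadj b x : Z b -> principal xi b x -> Z x.
Proof. by move=> hb [p hp <-]; apply: ZadjM. Qed.

(** Conjugation is a ring automorphism of [Z[xi]], so it suffices that it sends the generator into
    the ideal. *)
Lemma principal_conj b e x :
  Z e -> conjc b = e * b -> principal xi b x -> principal xi b (conjc x).
Proof.
move=> he cb [p hp <-]; rewrite conjcM cb -mulrA.
by rewrite mulrC; apply: principalM => //; apply: principalM => //;
   [exact: principal_gen|exact: Zadj_conj].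
Qed.

Lemma principal_mulC b x y : Z x -> principal xi b y -> principal xi b (x * y).
Proof. by move=> hx hy; rewrite mulrC; apply: principalM. Qed.

Lemma unit_norm u v x : x != 0 -> conjc x = u * x -> u * v = 1 -> `|v| = 1.
Proof.
move=> x0 e uv; have u1 : `|u| = 1.
  have nx : `|x| != 0 by rewrite normr_eq0.
  by apply: (mulIf nx); rewrite -normrM -e normcJ mul1r.
by rewrite -[LHS]mul1r -u1 -normrM uv normr1.
Qed.

(* The norm [b * conjc b] is such an integer. *)
Lemma principal_int b : Z b -> b != 0 ->
  exists2 N : nat, (0 < N)%N & principal xi b N%:R.
Proof.
have [k [sq cj im]] := xiP; move=> hb b0.
have bb : principal xi b (b * conjc b).
  by apply: principalM; [exact: principal_gen|exact: Zadj_conj].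
have [M eM] : exists M : int, b * conjc b = M%:~R.
  case: hb => m [n ->]; exists (m * m + m * n * k + n * n).
  rewrite conjcD conjcM !conjc_int cj !(intrD, intrM).
  transitivity (m%:~R * m%:~R + m%:~R * n%:~R * k%:~R +
    n%:~R * n%:~R * (k%:~R * xi - xi ^+ 2)); first by ring.
  by rewrite sq; ring.
have M0 : 0 < M.
  by rewrite -(ltr0z C) -eM -sqr_normc exprn_gt0 // normr_gt0.
exists `|M|%N; first by rewrite absz_gt0 gt_eqF.
by rewrite -[_%:R]/(`|M|%N%:~R) gtz0_abs // -eM.
Qed.

(** The ideal contains a positive integer [N], hence also [N xi]; reducing both coordinates modulo
    [N] leaves at most [N^2] cosets. *)
Lemma finite_cosets b : Z b -> b != 0 -> finite_set (cosets xi (principal xi b)).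
Proof.
move=> hb b0; have [N N0 hN] := principal_int hb b0.
have cN m : principal xi b (m%:~R * N%:R) by apply: principal_mulC => //; apply: Zadj_int.
pose f (p : 'I_N * 'I_N) := [set (p.1%:R + p.2%:R * xi : C) + g | g in principal xi b].
apply: (@sub_finite_set _ _ (f @` [set: 'I_N * 'I_N])); last first.
  by apply: finite_image; apply: finite_finset.
move=> _ [x [m [n ->]] <-].
have Nz : N%:Z != 0 by rewrite gt_eqF.
have mo (p : int) : exists i : 'I_N, exists q : int, p = i%:Z + q * N%:Z.
  have l := ltz_pmod p (N0 : 0 < N%:Z); have g := modz_ge0 p Nz.
  have lt : (`|(p %% N)%Z| < N)%N by lia.
  exists (Ordinal lt), (p %/ N)%Z; rewrite /= gez0_abs // {1}(divz_eq p N) addrC //.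
have [i [q em]] := mo m; have [j [r en]] := mo n.
exists (i, j) => //; rewrite /f /=.
have d : principal xi b (m%:~R + n%:~R * xi - (i%:R + j%:R * xi)).
  rewrite em en !(intrD, intrM).
  rewrite (_ : _ - _ = q%:~R * N%:R + r%:~R * N%:R * xi); last by rewrite -!pmulrn; ring.
  by apply: principalD => //; apply: principalM => //; exact: Zadj_xi.
apply/seteqP; split=> [_ [g hg <-]|_ [g hg <-]].
  by exists (g - (m%:~R + n%:~R * xi - (i%:R + j%:R * xi))); [exact: principalB|ring].
by exists (g + (m%:~R + n%:~R * xi - (i%:R + j%:R * xi))); [exact: principalD|ring].
Qed.

End Lattice.

(** * Regular polygons as convex hulls of their vertices *)

Section Polygon.
Variable R : realType.
Local Notation C := R[i].
Implicit Types (z c v x : C) (A B : set C).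

Definition convex_set A :=
  forall x y (s : R), A x -> A y -> 0 <= s <= 1 -> A (x + s%:C * (y - x)).

Definition vertex n c v k : C := c + (v - c) * zeta R n ^+ k.

Lemma norm_average n (w : 'I_n -> R) (x : 'I_n -> C) (d : C) :
  (forall k, 0 <= w k) -> \sum_(k < n) w k = 1 -> (forall k, `|x k| <= d) ->
  `|\sum_(k < n) (w k)%:C * x k| <= d.
Proof.
move=> w0 w1 xd; apply: (le_trans (ler_norm_sum _ _ _)).
rewrite -[d]mul1r -[1](rmorph1 (real_complex R)) -w1 rmorph_sum mulr_suml.
apply: ler_sum => k _; rewrite normrM ger0_norm ?lecR //.
by apply: ler_wpM2l; rewrite ?lecR.
Qed.

Lemma average_shift n (w : 'I_n -> R) (x : 'I_n -> C) a :
  \sum_(k < n) w k = 1 ->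
  \sum_(k < n) (w k)%:C * x k - a = \sum_(k < n) (w k)%:C * (x k - a).
Proof.
move=> w1; under [RHS]eq_bigr do rewrite mulrBr.
by rewrite sumrB -mulr_suml -rmorph_sum w1 mul1r.
Qed.

Lemma ngon_convex n c v : convex_set (ngon n c v).
Proof.
move=> _ _ s [w [w0 w1 ->]] [w' [w0' w1' ->]] /andP[s0 s1].
exists (fun k => (1 - s) * w k + s * w' k); split=> [k||].
- by rewrite addr_ge0 // mulr_ge0 // subr_ge0.
- by rewrite big_split /= -!mulr_sumr w1 w1' !mulr1 subrK.
- rewrite -sumrB mulr_sumr -big_split /=; apply: eq_bigr => k _.
  rewrite !(rmorphD, rmorphM, rmorphN, rmorph1) /=; ring.
Qed.

Lemma ngon_vertex n c v (k : 'I_n) : ngon n c v (vertex n c v k).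
Proof.
exists (fun j => (j == k)%:R); split=> [j||]; first exact: ler0n.
- by rewrite (bigD1 k) //= eqxx big1 ?addr0 // => j /negPf ->.
- rewrite (bigD1 k) //= eqxx mul1r big1 ?addr0 // => j /negPf ->.
  by rewrite mul0r.
Qed.

Lemma ngon_center n c v : (1 < n)%N -> ngon n c v c.
Proof.
move=> n1; have n0 : n%:R != 0 :> R by rewrite pnatr_eq0; lia.
exists (fun=> n%:R^-1); split=> [k||]; first by rewrite invr_ge0 ler0n.
- by rewrite sumr_const card_ord -[LHS]mulr_natr mulVf.
- rewrite -mulr_sumr big_split /= -mulr_sumr sum_zeta // mulr0 addr0.
  rewrite sumr_const card_ord -[c *+ n]mulr_natl mulrA.
  rewrite -(rmorph_nat (real_complex R)) -rmorphM.
  by rewrite mulVf // mul1r.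
Qed.

Lemma norm_vertex n c v (k : 'I_n) : `|vertex n c v k - c| = `|v - c|.
Proof.
rewrite /vertex addrAC subrr add0r normrM normrX norm_zeta ?expr1n ?mulr1 //.
exact: leq_ltn_trans (ltn_ord k).
Qed.

Lemma ngon_radius n c v z : ngon n c v z -> `|z - c| <= `|v - c|.
Proof.
move=> [w [w0 w1 ->]]; rewrite average_shift //.
by apply: norm_average => // k; rewrite norm_vertex.
Qed.

(** Distance is convex in each argument, so averaging over one point and then over the other reduces
    the bound to pairs of vertices. *)
Lemma ngon_diam n c v (d : C) :
  (forall j k : 'I_n, `|vertex n c v j - vertex n c v k| <= d) ->
  forall x y, ngon n c v x -> ngon n c v y -> `|x - y| <= d.
Proof.
move=> hd _ _ [w [w0 w1 ->]] [w' [w0' w1' ->]]; rewrite average_shift //.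
apply: norm_average => // j; rewrite distrC average_shift //.
by apply: norm_average => // k; rewrite distrC; exact: hd.
Qed.

(** The polygon lies in the disc of radius [|v - c|] about [c], and any move of a vertex straight
    away from [c] leaves that disc. *)
Lemma boundary_vertex n c v (k : 'I_n) :
  v != c -> boundary (ngon n c v) (vertex n c v k).
Proof.
move=> vc; split; first by apply: subset_closure; exact: ngon_vertex.
move=> /nbhs_ballP[e /= e0] sub.
have r0 : 0 < `|v - c| by rewrite normr_gt0 subr_eq0.
(* The factor [s] gives the displacement [s * (p - c)] the length [e / 2]. *)
pose p := vertex n c v k; pose s := e / 2 / `|v - c|.
have s0 : 0 < s by rewrite !divr_gt0.
have /ngon_radius : ngon n c v (p + s * (p - c)).
  apply: sub; rewrite -ball_normE /= opprD addNKr normrN normrM norm_vertex.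
  by rewrite gtr0_norm // divfK ?gt_eqF // gtr_pMr // invf_lt1 // ltr1n.
rewrite addrAC -[p - c in X in X + _]mul1r -mulrDl normrM norm_vertex.
rewrite ger0_norm ?addr_ge0 ?ler01 ?(ltW s0) //.
rewrite ger_pMl // => /le_lt_trans; move=> /(_ (1 + s)).
by rewrite ltrDl s0 ltxx => /(_ isT).
Qed.

(** Vertices are boundary points, so the finitely many distances between them are all below
    [|alpha|], and so is their maximum [d]. The lifting argument needs this uniform gap
    [|alpha| - d]. *)
Lemma bounded_diam n c v (alpha : C) : v != c -> alpha != 0 ->
  (forall x y, boundary (ngon n c v) x -> boundary (ngon n c v) y ->
     `|x - y| < `|alpha|) ->
  exists2 d : R, d%:C < `|alpha| &
    forall x y, ngon n c v x -> ngon n c v y -> `|x - y| <= d%:C.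
Proof.
move=> vc a0 hb.
pose f (jk : 'I_n * 'I_n) : R :=
  Normc.normc (vertex n c v jk.1 - vertex n c v jk.2).
exists (\big[Order.max/0]_jk f jk).
  rewrite -[`|alpha|]/((Normc.normc alpha)%:C) ltcR; apply/bigmax_ltP; split.
    by rewrite -ltcR -[X in _ < X]/(`|alpha|) normr_gt0.
  move=> [j k] _; rewrite -ltcR; apply: hb; exact: boundary_vertex.
apply: ngon_diam => j k; rewrite -[`|_|]/((f (j, k))%:C) lecR.
exact: le_bigmax.
Qed.

(* [c] is the only point within distance [|v - c|] of all vertices, since the
   mean of the squared distances from a point [x] to them is
   [|v - c|^2 + |x - c|^2]. *)
Lemma circumcenter_unique n c v x : (1 < n)%N ->
  (forall y, ngon n c v y -> `|y - x| <= `|v - c|) -> x = c.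
Proof.
move=> n1 hx; pose r := `|v - c|.
have : \sum_(k < n) `|vertex n c v k - x| ^+ 2 <= \sum_(k < n) r ^+ 2.
  apply: ler_sum => k _; rewrite lerXn2r ?nnegrE ?normr_ge0 // hx //.
  exact: ngon_vertex.
have -> : \sum_(k < n) `|vertex n c v k - x| ^+ 2 =
    \sum_(k < n) (r ^+ 2 + `|x - c| ^+ 2).
  have sz := sum_zeta R n1.
  (* The cross terms are linear in [zeta R n ^+ k] and its conjugate, so they cancel in the sum over
     [k]. *)
  have e (k : 'I_n) : `|vertex n c v k - x| ^+ 2 = r ^+ 2 + `|x - c| ^+ 2 +
     ((v - c) * conjc (c - x) * zeta R n ^+ k +
      conjc ((v - c) * conjc (c - x) * zeta R n ^+ k)).
    have zz : zeta R n ^+ k * conjc (zeta R n ^+ k) = 1.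
      by rewrite conj_norm1 // normrX norm_zeta ?expr1n //; lia.
    rewrite /r !sqr_normc /vertex !(conjcM, conjcD, conjcN, conjcK).
    (* A zero term, a multiple of [1 - 1] with one [1] rewritten by [zz], is added so that [ring]
       can close the identity. *)
    rewrite -[LHS]addr0 -(mulr0 ((v - c) * (conjc v - conjc c))) -(subrr 1) -{2}zz.
    ring.
  rewrite (eq_bigr _ (fun k _ => e k)) big_split /= [X in _ + X]big_split /=.
  by rewrite -rmorph_sum -mulr_sumr sz mulr0 rmorph0 !addr0.
rewrite !sumr_const card_ord lerMn2r; case: n n1 {hx} => //= n _.
rewrite gerDl => h; apply/eqP; rewrite -subr_eq0 -normr_eq0 -sqrf_eq0.
by rewrite eq_le h exprn_ge0.
Qed.

(* For the norm form of [Z[omega]], a convex combination of the cube roots of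
   unity has squared modulus [1 - 3 (w0 w1 + w1 w2 + w2 w0)]. *)
Lemma triangle_extreme c v x :
  ngon 3 c v x -> `|x - c| = `|v - c| -> exists k, x = vertex 3 c v k.
Proof.
have [->|vc] := eqVneq v c.
  move=> _ /eqP; rewrite subrr normr0 normr_eq0 subr_eq0 => /eqP ->.
  by exists 0%N; rewrite /vertex subrr mul0r addr0.
move=> [w [w0 w1 ->]]; rewrite average_shift //.
have -> : \sum_(k < 3) (w k)%:C * (vertex 3 c v k - c) =
    (v - c) * \sum_(k < 3) (w k)%:C * zeta R 3 ^+ k.
  by rewrite mulr_sumr; apply: eq_bigr => k _; rewrite /vertex; ring.
rewrite normrM => /eqP; rewrite -{2}[`|v - c|]mulr1.
rewrite (inj_eq (mulfI _)) ?normr_eq0 ?subr_eq0 //.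
move: w1; rewrite !big_ord_recl !big_ord0 /= !addr0 /bump /= !add1n /=.
move: (w0 ord0) (w0 (lift ord0 ord0)) (w0 (lift ord0 (lift ord0 ord0))).
move: (w (lift ord0 (lift ord0 ord0))) => d; move: (w (lift ord0 ord0)) => b.
move: (w ord0) => a {w w0} a0 b0 d0 abd.
rewrite -(@eqrXn2 _ 2) ?ler01 ?normr_ge0 // expr1n sqr_normc -/omega.
rewrite expr0 expr1 omega2 !mulr1.
rewrite !(conjcD, conjcM, conjcN, conjc1, conjc_real, conj_omega).
have -> : (a%:C + (b%:C * omega + d%:C * (-1 - omega))) *
    (a%:C + (b%:C * (-1 - omega) + d%:C * (-1 - (-1 - omega)))) =
    (a ^+ 2 + b ^+ 2 + d ^+ 2 - a * b - b * d - d * a)%:C.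
  rewrite !(rmorphD, rmorphN, rmorphM, rmorphXn) /=.
  move: (a%:C) (b%:C) (d%:C) => {}x y z.
  transitivity ((x - z) * (x - y) + ((x - z) * (z - y) + (y - z) * (x - y)) * omega
    + (y - z) * (z - y) * omega ^+ 2); first by ring.
  by rewrite omega2; ring.
rewrite -(rmorph1 (real_complex R)) (inj_eq (@complexI R)) => /eqP h.
have sq : (a + b + d) ^+ 2 = 1 by rewrite -[a + b + d]addrA abd expr1n.
(* Subtracting [h] from [sq] leaves [3 (a b + b d + d a) = 0] with nonnegative terms, so at most one
   weight is nonzero. *)
have ab0 := mulr_ge0 a0 b0; have bd0 := mulr_ge0 b0 d0; have da0 := mulr_ge0 d0 a0.
have ab : a * b = 0 by lra.
have bd : b * d = 0 by lra.
have da : d * a = 0 by lra.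
have [a_0|an] := eqVneq a 0; last first.
  have b_0 : b = 0 by apply: (mulfI an); rewrite ab mulr0.
  have d_0 : d = 0 by apply: (mulIf an); rewrite da mul0r.
  exists 0%N; have -> : a = 1 by lra.
  by rewrite b_0 d_0 /vertex expr0 !rmorph0 rmorph1; ring.
have [b_0|bn] := eqVneq b 0; last first.
  have d_0 : d = 0 by apply: (mulfI bn); rewrite bd mulr0.
  exists 1%N; have -> : b = 1 by lra.
  by rewrite a_0 d_0 /vertex expr1 -/omega !rmorph0 rmorph1; ring.
exists 2%N; have -> : d = 1 by lra.
by rewrite a_0 b_0 /vertex -/omega omega2 !rmorph0 rmorph1; ring.
Qed.

End Polygon.

(** * Lifting inclusions and equalities through [phi] *)

Section Lift.
Variables (R : realType) (alpha : R[i]).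
Hypothesis alpha0 : alpha != 0.
Local Notation C := R[i].
Implicit Types (A B : set C) (d : R).

Lemma int_shift_lt (k : int) : `|k%:~R * alpha| < `|alpha| -> k = 0.
Proof.
rewrite normrM gtr_pMl ?normr_gt0 // => h; apply/eqP; move: h.
by rewrite -intr_norm ltrz1; lia.
Qed.

(** Each point of [A] has its own multiple of [alpha]; the claim is that one multiple serves all.
    Translates of [B] by distinct multiples are at least [|alpha| - d] apart, so the multiple cannot
    change along a segment from [a0] cut into [N] pieces shorter than this gap. *)
Lemma lift_subset A B d a0 : convex_set A -> A a0 -> d%:C < `|alpha| ->
  (forall x y, B x -> B y -> `|x - y| <= d%:C) ->
  phi alpha @` A `<=` phi alpha @` B ->
  exists k : int, forall a, A a -> B (a + k%:~R * alpha).
Proof.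
move=> cA Aa0 hd dB sub.
have lft a : A a -> exists k : int, B (a + k%:~R * alpha).
  move=> Aa; have [b Bb /(phi_eq alpha0)[k e]] : (phi alpha @` B) (phi alpha a).
    by apply: sub; exists a.
  by exists k; rewrite -e.
have step a a' k : A a -> A a' -> `|a - a'| < `|alpha| - d%:C ->
    B (a + k%:~R * alpha) -> B (a' + k%:~R * alpha).
  move=> Aa Aa' h Ba; have [k' Ba'] := lft _ Aa'.
  suff /eqP : k - k' = 0 by rewrite subr_eq0 => /eqP ->.
  apply: int_shift_lt.
  have -> : (k - k')%:~R * alpha =
      (a + k%:~R * alpha - (a' + k'%:~R * alpha)) - (a - a').
    by rewrite intrB; ring.
  apply: (le_lt_trans (ler_normB _ _)).
  by rewrite -[`|alpha|](subrK d%:C) addrC ltr_leD // dB.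
have [k0 Bk0] := lft _ Aa0; exists k0 => a Aa.
have [N N0 hN] : exists2 N : nat, (0 < N)%N & `|a - a0| / N%:R < `|alpha| - d%:C.
  pose r := Normc.normc alpha - d; pose m := Normc.normc (a - a0).
  have r0 : 0 < r by rewrite subr_gt0 -ltcR.
  have m0 : 0 <= m by rewrite -lecR; exact: (normr_ge0 (a - a0)).
  exists (Num.truncn (m / r)).+1 => //.
  rewrite -[`|a - a0|]/(m%:C) -[`|alpha|]/((Normc.normc alpha)%:C).
  rewrite -rmorphB -(rmorph_nat (real_complex R)) -fmorphV -rmorphM ltcR -/r.
  rewrite ltr_pdivrMr ?ltr0n // mulrC -ltr_pdivrMr //.
  exact: truncnS_gt.
pose p (i : nat) := a0 + (i%:R / N%:R : R)%:C * (a - a0).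
have Ap i : (i <= N)%N -> A (p i).
  move=> iN; apply: cA => //.
  by rewrite divr_ge0 //= ler_pdivrMr ?ltr0n // mul1r ler_nat.
suff : B (p N + k0%:~R * alpha).
  by rewrite /p divff ?pnatr_eq0 -?lt0n // rmorph1 mul1r [a0 + _]addrC subrK.
suff sub_p i : (i <= N)%N -> B (p i + k0%:~R * alpha) by exact: sub_p.
elim: i => [|i IH] iN.
  by rewrite /p !mul0r addr0.
apply: step (IH (ltnW iN)); [exact: Ap (ltnW iN)|exact: Ap|].
rewrite distrC /p -natr1 (_ : _ - _ = (a - a0) / N%:R); last first.
  rewrite !(rmorphM, rmorphD, rmorph1, fmorphV, rmorph_nat) /=; ring.
by rewrite normrM normfV normr_nat.
Qed.

(** The inclusions in both directions compose to a translation of [A] into itself by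
    [(k + j) alpha], which the diameter bound forces to be zero. *)
Lemma lift_eq A B d a0 : convex_set A -> convex_set B -> A a0 ->
  d%:C < `|alpha| ->
  (forall x y, A x -> A y -> `|x - y| <= d%:C) ->
  (forall x y, B x -> B y -> `|x - y| <= d%:C) ->
  phi alpha @` A = phi alpha @` B ->
  exists k : int, [set a + k%:~R * alpha | a in A] = B.
Proof.
move=> cA cB Aa0 hd dA dB e.
have [k hk] : exists k : int, forall a, A a -> B (a + k%:~R * alpha).
  by apply: (lift_subset cA Aa0 hd dB); rewrite e.
have [j hj] : exists j : int, forall b, B b -> A (b + j%:~R * alpha).
  by apply: (lift_subset cB (hk _ Aa0) hd dA); rewrite e.
have kj : k + j = 0.
  apply: int_shift_lt; apply: (le_lt_trans _ hd).
  have := dA _ _ (hj _ (hk _ Aa0)) Aa0.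
  by rewrite (_ : _ - _ = (k + j)%:~R * alpha) // intrD; ring.
exists k; apply/seteqP; split=> [_ [a Aa <-]|b Bb]; first exact: hk.
exists (b + j%:~R * alpha); first exact: hj.
by rewrite -addrA -mulrDl -intrD [j + k]addrC kj mul0r addr0.
Qed.

End Lift.

(** * Centers, vertices and translations of the three tilings *)

Section Tiles.
Variables (R : realType) (T : regular_tiling).
Local Notation C := R[i].
Local Notation xi := (xi R T).
Local Notation Z := (Zadj xi).
Local Notation sides := (sides T).
Implicit Types (x y z c v : C).

(** For the triangles this ideal is also the lattice of vertices, the complement of the centers in
    [Z[xi]]. *)
Definition translation_lattice : set C :=
  match T with T44 | T63 => Z | T36 => principal xi (2 + omega) end.

Local Notation translations := translation_lattice.

Lemma sides_gt1 : (1 < sides)%N.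
Proof. by case: T. Qed.

Lemma centers_Zadj c : centers T c -> Z c.
Proof. by rewrite /centers; case: T => // -[]. Qed.

Lemma sqr_norm_2_omega : `|2 + omega : C| ^+ 2 = 3.
Proof.
rewrite sqr_normc conjcD conj_omega (conjc_nat R 2).
transitivity (2 - omega - omega ^+ 2 : C); first by ring.
by rewrite omega2; ring.
Qed.

Lemma sqr_norm_1_i : `|1 + imagi : C| ^+ 2 = 2.
Proof. by rewrite -add_Re2_Im2 /= addr0 add0r expr1n rmorphD. Qed.

Definition circumradius2 : C := match T with T44 => 2^-1 | T63 => 3^-1 | T36 => 1 end.

Lemma sqr_norm_vertex c v : tile_vertex T c v -> `|v - c| ^+ 2 = circumradius2.
Proof.
rewrite /tile_vertex /circumradius2; case: T => [->|->|[_ ->]]; last by rewrite expr1n.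
- rewrite addrAC subrr add0r normrM exprMn sqr_norm_1_i normfV normr_nat.
  by rewrite exprVn; field.
- rewrite addrAC subrr add0r normrM exprMn sqr_norm_2_omega normfV normr_nat.
  by rewrite exprVn; field.
Qed.

Lemma eq_norm_vertex c v c' v' :
  tile_vertex T c v -> tile_vertex T c' v' -> `|v - c| = `|v' - c'|.
Proof.
by move=> /sqr_norm_vertex h /sqr_norm_vertex h'; apply/eqP;
  rewrite -(@eqrXn2 _ 2) // h h'.
Qed.

Lemma vertex_neq_center c v : tile_vertex T c v -> v != c.
Proof.
move=> /sqr_norm_vertex h; rewrite -subr_eq0 -normr_eq0 -sqrf_eq0 h.
by rewrite /circumradius2; case: T; rewrite ?invr_eq0 ?oner_eq0 ?pnatr_eq0.
Qed.

(** The squared modulus of [m + n omega] is [m^2 - m n + n^2]; the value [1] confines [m] and [n] to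
    [-1], [0], [1] and leaves the six units. *)
Lemma omega_unit_norm1 x : Zadj omega x -> `|x| = 1 ->
  exists j : nat, x = omega ^+ j \/ x = - omega ^+ j.
Proof.
move=> [m [n ->]] nx; have : m * m - m * n + n * n = 1.
  have := conj_norm1 nx; rewrite conjcD conjcM !(conjc_int R) conj_omega => e.
  apply/eqP; rewrite -(eqr_int C) !(intrD, intrM, mulrNz) -[1%:~R]e; apply/eqP.
  transitivity (m%:~R * m%:~R - m%:~R * n%:~R
    - n%:~R * n%:~R * (omega + omega ^+ 2) : C); first by rewrite omega2; ring.
  ring.
move=> e.
have hm : (-1 <= m <= 1)%R by nia.
have hn : (-1 <= n <= 1)%R by nia.
have [[]|[[]|[]]] : (n = 0 /\ (m = 1 \/ m = -1)) \/ (m = 0 /\ (n = 1 \/ n = -1)) \/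
    (m = n /\ (m = 1 \/ m = -1)) by nia.
- by move=> -> [->|->]; exists 0%N; [left|right]; rewrite ?mulrNz mul0r addr0.
- by move=> -> [->|->]; exists 1%N; [left|right]; rewrite ?mulrNz ?mulN1r ?mul1r add0r.
- by move=> <- [->|->]; exists 2; [right|left]; rewrite omega2 ?mulrNz; ring.
Qed.

Lemma ngon_vertexn n c v k : (0 < n)%N -> ngon n c v (vertex n c v k).
Proof.
move=> n0; have := @ngon_vertex R n c v (Ordinal (ltn_pmod k n0)).
by rewrite /vertex /= expr_mod // zetaX.
Qed.

(* Both orientations of the triangles centered at [c] contain [c + 1 / 2]: it is
   the midpoint of the center and a vertex, or the midpoint of a side. *)
Lemma common_point : exists2 w : C, w != 0 &
  forall c v, centers T c -> tile_vertex T c v -> ngon sides c v (c + w).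
Proof.
have v0 n c v : (0 < n)%N -> ngon n c v v.
  by move=> /(ngon_vertexn c v 0); rewrite /vertex expr0 mulr1 addrC subrK.
rewrite /centers /tile_vertex /Defs.sides /Defs.xi; case: T.
- exists ((1 + imagi) / 2) => [|c v _ ->]; last exact: v0.
  rewrite mulf_neq0 ?invr_eq0 ?pnatr_eq0 //.
  by rewrite -normr_eq0 -sqrf_eq0 sqr_norm_1_i pnatr_eq0.
- exists ((2 + omega) / 3) => [|c v _ ->]; last exact: v0.
  rewrite mulf_neq0 ?invr_eq0 ?pnatr_eq0 //.
  by rewrite -normr_eq0 -sqrf_eq0 sqr_norm_2_omega pnatr_eq0.
- exists 2^-1 => [|c v [Zc _] [Pv n1]]; first by rewrite invr_eq0 pnatr_eq0.
  have Zv : Zadj omega v.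
    apply: (@principal_Zadj R T36 _ _ _ Pv); apply: (@ZadjD R T36).
      exact: (@Zadj_int R T36 2).
    exact: (@Zadj_xi R T36).
  have [j hj] := omega_unit_norm1 (@ZadjB R T36 _ _ Zv Zc) n1.
  (* Since [omega ^+ 3 = 1], the exponent [2 * j] inverts [omega ^+ j]; this renumbers the vertices
     independently of [v]. *)
  have wj i : omega ^+ j * omega ^+ (i + 2 * j) = omega ^+ i :> C.
    rewrite -exprD (_ : (j + (i + 2 * j) = i + 3 * j)%N); last by lia.
    by rewrite exprD exprM -[omega ^+ 3]/(zeta R 3 ^+ 3) zetaX // expr1n mulr1.
  have v3 := fun i => @ngon_vertexn 3 c v (i + 2 * j) isT.
  have half : 0 <= (2^-1 : R) <= 1 by rewrite invr_ge0 ler0n invf_le1 ?ler1n.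
  have h2 : (2^-1 : R)%:C = 2^-1 by rewrite fmorphV rmorph_nat.
  case: hj => hj.
    have c1 : ngon 3 c v (c + 1).
      by have := v3 0%N; rewrite /vertex hj wj expr0.
    have := @ngon_convex R 3 c v _ _ _ (@ngon_center R 3 c v isT) c1 half.
    by rewrite h2 [c + 1]addrC addrK mulr1.
  have c1 : ngon 3 c v (c - omega).
    by have := v3 1%N; rewrite /vertex hj mulNr wj expr1.
  have c2 : ngon 3 c v (c - omega ^+ 2).
    by have := v3 2%N; rewrite /vertex hj mulNr wj.
  have := @ngon_convex R 3 c v _ _ _ c1 c2 half; rewrite h2 omega2.
  by congr (ngon _ _ _ _); field.
Qed.

Lemma Zadj_omega_2 : T = T36 -> Z (2 + omega).
Proof.
move=> e; have -> : omega = xi by rewrite /Defs.xi e.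
by apply: ZadjD; [exact: (Zadj_int R T 2)|exact: Zadj_xi].
Qed.

Lemma translations_Zadj x : translations x -> Z x.
Proof.
have := Zadj_omega_2; rewrite /translation_lattice; case: T => // /(_ erefl) h.
exact: principal_Zadj.
Qed.

Lemma translationsD x y : translations x -> translations y -> translations (x + y).
Proof.
by rewrite /translation_lattice; case: T;
  [exact: ZadjD|exact: ZadjD|exact: principalD].
Qed.

Lemma translationsN x : translations x -> translations (- x).
Proof.
by rewrite /translation_lattice; case: T;
  [exact: ZadjN|exact: ZadjN|exact: principalN].
Qed.

Lemma translationsM x y : Z x -> translations y -> translations (x * y).
Proof.
by rewrite /translation_lattice; case: T;
  [exact: ZadjM|exact: ZadjM|exact: principal_mulC].
Qed.

(** For the triangles, [conjc (2 + omega) = - omega * (2 + omega)]. *)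
Lemma translations_conj x : translations x -> translations (conjc x).
Proof.
rewrite /translation_lattice; case: T; [exact: Zadj_conj|exact: Zadj_conj|].
apply: (@principal_conj R T36 _ (- omega)); first by apply: ZadjN; exact: (@Zadj_xi R T36).
rewrite conjcD conj_omega (conjc_nat R 2).
transitivity (-2 * omega - omega ^+ 2 : C); first by rewrite omega2; ring.
rewrite /Defs.xi; ring.
Qed.

Lemma centersP c : centers T c <-> Z c /\ (T = T36 -> ~ translations c).
Proof.
rewrite /centers /translation_lattice; case: T; split.
- by move=> h; split.
- by case.
- by move=> h; split.
- by case.
- by case=> h1 h2; split.
- by case=> h1 h2; split=> //; exact: h2.
Qed.

(** A supply of centers common to all three tilings. For the triangles, [3] is the norm of
    [2 + omega], so [3 * s] is a vertex, while [1] is outside the ideal because its norm is not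
    divisible by [3]. *)
Lemma exists_tile s : Z s ->
  exists v, centers T (1 + 3 * s) /\ tile_vertex T (1 + 3 * s) v.
Proof.
rewrite /centers /tile_vertex; case: T => hs.
- eexists; split; last by reflexivity.
  apply: ZadjD; first exact: (Zadj_int R T44 1).
  by apply: ZadjM => //; exact: (Zadj_int R T44 3).
- eexists; split; last by reflexivity.
  apply: ZadjD; first exact: (Zadj_int R T63 1).
  by apply: ZadjM => //; exact: (Zadj_int R T63 3).
- have Z2 : Zadj (Defs.xi R T36) (2 + omega).
    by apply: ZadjD; [exact: (Zadj_int R T36 2)|exact: (@Zadj_xi R T36)].
  have P3 : principal (Defs.xi R T36) (2 + omega) (3 * s).
    apply: principalM => //; rewrite -sqr_norm_2_omega sqr_normc.
    by apply: principalM; [exact: principal_gen|exact: Zadj_conj].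
  exists (3 * s); split; last first.
    by split=> //; rewrite opprD addrCA subrr addr0 normrN normr1.
  split; first by apply: ZadjD; [exact: (Zadj_int R T36 1)|exact: principal_Zadj P3].
  move=> /principalB /(_ P3); rewrite addrK => -[_ [m [n ->]] e].
  suff : 3 * (m * m - m * n + n * n) = 1 :> int by lia.
  have := congr1 (fun x => `|x| ^+ 2) e; rewrite normr1 expr1n normrM exprMn.
  rewrite sqr_norm_2_omega sqr_normc /Defs.xi.
  rewrite conjcD conjcM !(conjc_int R) conj_omega => e2.
  apply/eqP; rewrite -(eqr_int C) !(intrD, mulrNz, intrM); apply/eqP.
  apply: etrans e2.
  transitivity (3 * (m%:~R * m%:~R - m%:~R * n%:~R
    - n%:~R * n%:~R * (omega + omega ^+ 2)) : C); first by rewrite omega2; ring.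
  ring.
Qed.

End Tiles.

(** * Linear symmetries of the lattice and their action on the coloring *)

Section LatticeSymmetries.
Variables (R : realType) (T : regular_tiling) (alpha beta : R[i]).
Hypothesis halpha : admissible T alpha.
Local Notation C := R[i].
Local Notation xi := (xi R T).
Local Notation Z := (Zadj xi).
Local Notation translations := (@translation_lattice R T).
Local Notation K := (ideal_coloring T beta).
Implicit Types (x y z c v : C) (H : C -> C) (h : C -> C).

(** The properties shared by the identity and the lifted reflection, so that both are treated at
    once. Being an involution, [H] serves as its own inverse. *)
Record lattice_symmetry H : Prop := LatticeSymmetry {
  lsymD : forall x y, H (x + y) = H x + H y;
  lsymZ : forall (s : R) x, H (s%:C * x) = s%:C * H x;
  lsym_norm : forall x, `|H x| = `|x|;
  lsymK : forall x, H (H x) = x;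
  lsym_Zadj : forall x, Z x -> Z (H x);
  lsym_translations : forall x, translations x -> translations (H x);
  lsym_ideal : forall x, principal xi beta x -> principal xi beta (H x) }.

Lemma lattice_symmetry_id : lattice_symmetry id.
Proof. by split. Qed.

Lemma lattice_symmetry_conj e :
  Z e -> `|e| = 1 -> (exists2 u, Z u & conjc beta = u * beta) ->
  lattice_symmetry (fun z => e * conjc z).
Proof.
move=> Ze e1 [u Zu hu]; split=> [x y|s x|x|x|x hx|x hx|x hx].
- by rewrite conjcD mulrDr.
- by rewrite conjcM conjc_real mulrCA.
- by rewrite normrM e1 mul1r normcJ.
- by rewrite conjcM conjcK mulrA conj_norm1 // mul1r.
- by apply: ZadjM => //; exact: Zadj_conj.
- by apply: translationsM => //; exact: translations_conj.
- by apply: principal_mulC => //; exact: principal_conj Zu hu hx.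
Qed.

Section Symmetry.
Variable H : C -> C.
Hypothesis hH : lattice_symmetry H.

Lemma lsymN x : H (- x) = - H x.
Proof.
have := lsymZ hH (-1) x.
by rewrite rmorphN rmorph1 !mulN1r.
Qed.

Lemma lsymB x y : H (x - y) = H x - H y.
Proof. by rewrite (lsymD hH) lsymN. Qed.

Lemma lsym_centers c s : centers T c -> translations s -> centers T (H c + s).
Proof.
move=> /centersP[Zc nc] hs; apply/centersP; split.
  by apply: ZadjD; [exact: (lsym_Zadj hH)|exact: translations_Zadj].
move=> e /translationsD /(_ (translationsN hs)); rewrite addrK.
by move=> /(lsym_translations hH); rewrite (lsymK hH); exact: nc.
Qed.

Lemma image_centers s : translations s ->
  [set H c + s | c in centers T] = centers T.
Proof.
move=> hs; apply/seteqP; split=> [_ [c hc <-]|c hc]; first exact: lsym_centers.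
exists (H c - H s); last by rewrite lsymB !(lsymK hH) subrK.
by apply: lsym_centers => //; apply: translationsN; exact: (lsym_translations hH).
Qed.

Lemma image_class s Y : translations s -> K Y -> K [set H y + s | y in Y].
Proof.
move=> hs [[y0 Yy0] [_ [x Zx <-] eY]]; split.
  by exists (H y0 + s); exists y0.
exists [set (H x + s) + g | g in principal xi beta].
  exists (H x + s) => //; apply: ZadjD; first exact: (lsym_Zadj hH).
  exact: translations_Zadj.
apply/seteqP; split=> [_ [y Yy <-]|z [[g hg <-] hz]].
  move: Yy; rewrite eY => -[[g hg <-] hc]; split; last exact: lsym_centers.
  exists (H g); first exact: (lsym_ideal hH).
  by rewrite (lsymD hH); ring.
(* For [z = H x + s + g] this is the preimage [H (z - s)]. *)
exists (x + H g); last by rewrite (lsymD hH) (lsymK hH); ring.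
rewrite eY; split; first by exists (H g) => //; exact: (lsym_ideal hH).
have := lsym_centers hz (translationsN (lsym_translations hH hs)).
by rewrite !(lsymD hH) !(lsymK hH) -[x + _ + _]addrA [H s + _]addrC addrA addrK.
Qed.

Lemma tile_diam c v : centers T c -> tile_vertex T c v ->
  exists2 d : R, d%:C < `|alpha| &
    forall x y, ngon (sides T) c v x -> ngon (sides T) c v y -> `|x - y| <= d%:C.
Proof.
move=> hc hv; have [a0 _ hb] := halpha.
apply: bounded_diam => //; first exact: vertex_neq_center hv.
by move=> x y; apply: hb; exists c, v.
Qed.

(* If [z |-> H z + t] matches two tiles modulo [alpha Z], a shift of it maps
   one onto the other, hence center to center and, for the triangles, vertex to
   vertex. *)
Lemma shift_translations t c v c' v' :
  centers T c -> tile_vertex T c v -> centers T c' -> tile_vertex T c' v' ->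
  phi alpha @` [set H z + t | z in ngon (sides T) c v] =
    phi alpha @` ngon (sides T) c' v' ->
  exists k : int, translations (t + k%:~R * alpha).
Proof.
move=> hc hv hc' hv' e; have [a0 _ _] := halpha.
have [d1 d1a hd1] := tile_diam hc hv; have [d2 d2a hd2] := tile_diam hc' hv'.
have dN x y : `|H x + t - (H y + t)| = `|x - y|.
  by rewrite opprD addrACA subrr addr0 -lsymB (lsym_norm hH).
have [||||||k hk] := @lift_eq R alpha a0 [set H z + t | z in ngon (sides T) c v]
    (ngon (sides T) c' v') (Order.max d1 d2) (H c + t) _ _ _ _ _ _ e.
- move=> _ _ s [x hx <-] [y hy <-] hs; exists (x + s%:C * (y - x)).
    exact: ngon_convex.
  by rewrite (lsymD hH) (lsymZ hH) lsymB; ring.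
- exact: ngon_convex.
- by exists c => //; apply: ngon_center; exact: sides_gt1.
- by case: (leP d1 d2).
- move=> _ _ [x hx <-] [y hy <-]; rewrite dN; apply: (le_trans (hd1 _ _ hx hy)).
  by rewrite lecR le_max lexx.
- move=> x y hx hy; apply: (le_trans (hd2 _ _ hx hy)).
  by rewrite lecR le_max lexx orbT.
exists k; set t' := t + _.
pose M z := H z + t'.
have hM z : ngon (sides T) c v z -> ngon (sides T) c' v' (M z).
  by move=> hz; rewrite -hk; exists (H z + t); [exists z|rewrite -addrA].
have MN x y : `|M x - M y| = `|x - y|.
  by rewrite opprD addrACA subrr addr0 -lsymB (lsym_norm hH).
have Mc : M c = c'.
  apply: (@circumcenter_unique R (sides T) c' v'); first exact: sides_gt1.
  move=> y; rewrite -hk => -[_ [z hz <-] <-].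
  have -> : H z + t + k%:~R * alpha = M z by rewrite /M addrA.
  rewrite MN.
  by rewrite -(eq_norm_vertex hv hv'); exact: ngon_radius hz.
have t'E : t' = c' - H c by rewrite -Mc /M addrC addKr.
have Zt' : Z t'.
  rewrite t'E; apply: ZadjB; first exact: centers_Zadj.
  by apply: (lsym_Zadj hH); exact: centers_Zadj.
have t'v : t' = M v - H v by rewrite /M addrC addKr.
have : translations (H v) -> translations (M v) -> translations t'.
  by move=> h1 h2; rewrite t'v; apply: translationsD => //; exact: translationsN.
have := lsym_translations hH.
have := @centers_Zadj R T _ hc'.
have : ngon (sides T) c' v' (M v).
  apply: hM; have := @ngon_vertexn R (sides T) c v 0.
  by rewrite /vertex expr0 mulr1 addrC subrK; apply; exact: ltnW (sides_gt1 T).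
have : `|M v - c'| = `|v' - c'| by rewrite -Mc MN (eq_norm_vertex hv hv') Mc.
move: hv hv' Zt'; rewrite /tile_vertex /translation_lattice /Defs.sides.
(* For squares and hexagons [Zt'] is already the goal; for triangles it remains to see that [M v] is
   a vertex of the tiling. *)
case: T => // -[Pv _] [Pv' _] _ nM nv Zc' hP h.
apply: h; first exact: hP.
have [j ->] := triangle_extreme nv nM.
have Zw i : Zadj (Defs.xi R T36) (omega ^+ i).
  elim: i => [|i IH]; first exact: Zadj1.
  by rewrite exprS; apply: ZadjM => //; exact: (@Zadj_xi R T36).
(* [1 - omega] divides [1 - omega ^+ j] and is an associate of [2 + omega]; hence turning the vertex
   [v'] about [c'] stays in the vertex lattice. *)
have P1w : principal (Defs.xi R T36) (2 + omega) (1 - omega ^+ j).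
  elim: j => [|j IH].
    rewrite subrr -(subrr (2 + omega)); apply: principalB; exact: principal_gen.
  have -> : 1 - omega ^+ j.+1 = 1 - omega ^+ j + omega ^+ j * (1 - omega) :> C.
    by rewrite exprSr; ring.
  apply: principalD => //; apply: principal_mulC => //.
  exists (- omega); first by apply: ZadjN; exact: (@Zadj_xi R T36).
  transitivity (-2 * omega - omega ^+ 2 : C); first by ring.
  by rewrite omega2; ring.
rewrite (_ : vertex _ _ _ _ = v' * omega ^+ j + c' * (1 - omega ^+ j)).
  by apply: principalD; [exact: principalM|exact: principal_mulC].
by rewrite /vertex -/omega; ring.
Qed.

Hypothesis Zbeta : Z beta.
Hypothesis beta0 : beta != 0.
Hypothesis hcompat : compatible alpha K.

Lemma image_coloringP : is_coloring (Q_ T alpha) (image_coloring alpha K).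
Proof.
split.
  apply: finite_image.
  pose f X := X `&` centers T : set C.
  apply: (@sub_finite_set _ _ (f @` cosets xi (principal xi beta))).
    by move=> Y [_ [X hX ->]]; exists X.
  by apply: finite_image; exact: finite_cosets.
split.
- apply/seteqP; split=> [z [_ [Y [_ [X _ eY]] <-] /= [y Yy <-]]|_ [c hc <-]].
    by exists y => //; move: Yy; rewrite eY => -[].
  have cX : ([set c + g | g in principal xi beta] `&` centers T) c.
    split=> //; exists 0; last by rewrite addr0.
    by rewrite -(subrr beta); apply: principalB; exact: principal_gen.
  exists (phi alpha @` ([set c + g | g in principal xi beta] `&` centers T)).
    exists ([set c + g | g in principal xi beta] `&` centers T) => //; split.
      by exists c.
    exists [set c + g | g in principal xi beta] => //.
    by exists c => //; exact: centers_Zadj.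
  by exists c.
- move=> _ _ [Y hY <-] [Y' hY' <-] /= ne; congr (phi alpha @` _).
  exact: hcompat.
- by move=> _ [Y [[y Yy] _] <-]; exists (phi alpha y); exists y.
Qed.

Lemma color_symmetry_translations h t : isometry h -> translations t ->
  (forall z, h (phi alpha z) = phi alpha (H z + t)) ->
  color_symmetry (Q_ T alpha) (image_coloring alpha K) h.
Proof.
move=> hi ht hphi.
have im A : h @` (phi alpha @` A) = phi alpha @` [set H z + t | z in A].
  by apply/seteqP; split=> [_ [_ [z hz <-] <-]|_ [_ [z hz <-] <-]];
    [exists (H z + t); [exists z|]|exists (phi alpha z); [exists z|]];
    rewrite ?hphi.
have inj := isometry_inj hi.
split; first exact: image_coloringP.
  by split=> //; rewrite /Q_ im image_centers.
exists (fun Y => h @` Y); last by move=> Y x _ Yx; exists x.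
split.
- by move=> _ [Y hY <-]; rewrite im; exists [set H z + t | z in Y] => //;
    exact: image_class.
- move=> A B _ _ e; apply/seteqP; split=> x hx.
    have : (h @` A) (h x) by exists x.
    by rewrite e => -[y hy /inj <-].
  have : (h @` B) (h x) by exists x.
  by rewrite -e => -[y hy /inj <-].
- move=> _ [Y hY <-]; pose Y' := [set H y + - H t | y in Y].
  exists (phi alpha @` Y').
    exists Y' => //; apply: image_class => //; apply: translationsN.
    exact: (lsym_translations hH).
  rewrite im; congr (_ @` _); apply/seteqP; split=> [_ [_ [y hy <-] <-]|y hy].
    by rewrite (lsymD hH) lsymN !(lsymK hH) subrK.
  exists (H y - H t); first by exists y.
  by rewrite lsymB !(lsymK hH) subrK.
Qed.

(** A single sample tile determines [t] up to a multiple of [alpha], and such a multiple does not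
    affect [phi]. *)
Lemma color_symmetry_lift h t : sym_tiles (S_ T alpha) h ->
  (forall z, h (phi alpha z) = phi alpha (H z + t)) ->
  color_symmetry (Q_ T alpha) (image_coloring alpha K) h.
Proof.
move=> [hi hS] hphi; have [a0 _ _] := halpha.
have Z0 : Z 0 by exact: (Zadj_int R T 0).
have [v [hc hv]] := exists_tile Z0; set c := 1 + _ in hc hv.
have : S_ T alpha (h @` (phi alpha @` ngon (sides T) c v)).
  rewrite -hS; exists (phi alpha @` ngon (sides T) c v) => //.
  by exists (ngon (sides T) c v) => //; exists c, v.
move=> [_ [c' [v' [hc' hv' ->]]] e].
have [k hk] : exists k : int, translations (t + k%:~R * alpha).
  apply: (shift_translations hc hv hc' hv'); rewrite e.
  by apply/seteqP; split=> [_ [_ [z hz <-] <-]|_ [_ [z hz <-] <-]];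
    [exists (phi alpha z); [exists z|]|exists (H z + t); [exists z|]];
    rewrite ?hphi.
apply: color_symmetry_translations hi hk _ => z.
by rewrite addrA phi_shift.
Qed.

End Symmetry.
End LatticeSymmetries.

(** * Symmetries of the image tiling fix the origin *)

Section FixZero.
Variables (R : realType) (T : regular_tiling) (alpha : R[i]).
Hypothesis halpha : admissible T alpha.
Local Notation C := R[i].
Local Notation xi := (xi R T).
Local Notation Z := (Zadj xi).
Local Notation phi := (phi alpha).
Implicit Types (z w c v : C) (h : C -> C).

Let alpha0 : alpha != 0.
Proof. by case: halpha. Qed.

Lemma norm_ge_Im z : (- complex.Im z)%:C <= `|z|.
Proof.
have := normc_ge_Re (z * 'i%C); rewrite ReiNIm normrM (_ : `|'i%C| = 1) ?mulr1.
  by apply: le_trans; rewrite lecR ler_norm.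
by apply/eqP; rewrite -(@pexpr_eq1 _ _ 2) // sqr_normc; simpc.
Qed.

(** Applied to [w = z - c] for [z] in a tile centered at [c], it bounds [|phi z|] by a fixed
    multiple of [|phi c|]. *)
Lemma norm_phi_le w : `|w| <= `|alpha| -> `|phi w| <= (expR (2 * pi))%:C.
Proof.
move=> hw; rewrite norm_phi lecR ler_expR mulNr -mulrN.
rewrite ger_pMr ?mulr_gt0 ?pi_gt0 // -lecR; apply: (le_trans (norm_ge_Im _)).
by rewrite normrM normfV ler_pdivrMr ?normr_gt0 // mul1r.
Qed.

(** Since [xi] is not real, [1] and [xi] cannot both be real multiples of [alpha], so some [s] has
    [Im (s / alpha) > 0]. Along the centers [1 + 3 n s] the modulus of [phi] then decays
    exponentially. *)
Lemma small_center (d : R) : 0 < d -> exists c v,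
  [/\ centers T c, tile_vertex T c v & `|phi c| <= d%:C].
Proof.
move=> d0; have [s Zs s0] : exists2 s, Z s & 0 < complex.Im (s / alpha).
  have [s Zs s0] : exists2 s, Z s & complex.Im (s / alpha) != 0.
    have [i0|i1] := eqVneq (complex.Im (1 / alpha)) 0; last first.
      by exists 1 => //; exact: Zadj1.
    exists xi; first exact: Zadj_xi.
    have [k [_ _ im]] := xiP R T; rewrite -[xi]mulr1 -mulrA Im_mulc i0 mulr0 add0r.
    apply: mulf_neq0 => //; apply: contraNneq (invr_neq0 alpha0) => r0.
    by rewrite -[_^-1]mul1r; apply/eqP; exact: (@complex_ext R (1 / alpha) 0 r0 i0).
  move: s0; rewrite neq_lt => /orP[s0|s0]; last by exists s.
  by exists (- s); [exact: ZadjN|rewrite mulNr Im_oppc oppr_gt0].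
have e0 : 0 < 6 * pi * complex.Im (s / alpha) by rewrite !mulr_gt0 ?pi_gt0.
(* After logarithms, the bound by [d] reads [q <= n * (6 pi Im (s / alpha))]. *)
set q := - ln d - 2 * pi * complex.Im (alpha^-1).
pose n := (Num.truncn (q / (6 * pi * complex.Im (s / alpha)))).+1.
have Zns : Z (n%:R * s) by apply: ZadjM => //; exact: (Zadj_int R T n).
have [v [hc hv]] := exists_tile Zns; exists (1 + 3 * (n%:R * s)), v; split=> //.
rewrite norm_phi lecR -(lnK d0) ler_expR.
have hn : q < n%:R * (6 * pi * complex.Im (s / alpha)).
  by rewrite -ltr_pdivrMr //; exact: truncnS_gt.
have -> : (1 + 3 * (n%:R * s)) / alpha = alpha^-1 + (3 * n%:R : R)%:C * (s / alpha).
  by rewrite rmorphM !rmorph_nat; ring.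
by rewrite Im_addc Im_mulc /= mul0r addr0; move: hn; rewrite /q; lra.
Qed.

(* If [h 0 = t] with [t != 0], then [h] maps tiles near [0], which are
   arbitrarily small, to tiles near [t], whose size is bounded below. *)
Lemma sym_tiles_fix0 h : sym_tiles (S_ T alpha) h -> h 0 = 0.
Proof.
move=> [hi hS]; apply/eqP; apply: contraT => t0; exfalso.
have [w w0 hw] := common_point R T.
pose M := expR (2 * pi) : R.
have M0 : 0 < M by exact: expR_gt0.
pose t := Normc.normc (h 0); pose m := Normc.normc (phi w - 1).
have t_gt0 : 0 < t by rewrite -ltcR; rewrite -normr_gt0 in t0.
have wa : `|w| < `|alpha|.
  have [v [hc hv]] := exists_tile (Zadj_int R T 0).
  have [d da hd] := tile_diam halpha hc hv.
  apply: le_lt_trans da; rewrite -[w](addrK (1 + 3 * 0%:~R)).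
  rewrite [w + _]addrC; apply: hd; first exact: hw.
  by apply: ngon_center; exact: sides_gt1.
(* [m] is the distance from [phi c'] to [phi (c' + w)] relative to [|phi c'|]; it is nonzero because
   [w] is nonzero and too short to be a period. *)
have m_gt0 : 0 < m.
  rewrite -ltcR; change (0 < `|phi w - 1|).
  rewrite normr_gt0 subr_eq0; apply: contraNneq w0 => /(phi_eq1 alpha0)[k wk].
  by move: wa; rewrite wk => /(int_shift_lt alpha0) ->; rewrite mul0r.
(* The first bound gives [M d <= t / 2], so the two chosen points of the image tile are at least
   [t m / 2] apart. The second makes this at least [(5 / 2) M d], against the upper bound
   [2 M d]. *)
pose d := Order.min (t / (2 * M)) (t * m / (5 * M)).
have d0 : 0 < d by rewrite lt_min !divr_gt0 ?mulr_gt0.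
have [c [v [hc hv hd]]] := small_center d0.
have small x : (phi @` ngon (sides T) c v) x -> `|x| <= (M * d)%:C.
  move=> [z hz <-]; rewrite -[z](subrK c) phiD normrM rmorphM.
  apply: ler_pM => //; apply: norm_phi_le.
  have [e ea he] := tile_diam halpha hc hv.
  apply/ltW/(le_lt_trans _ ea); apply: he => //.
  by apply: ngon_center; exact: sides_gt1.
have : S_ T alpha (h @` (phi @` ngon (sides T) c v)).
  rewrite -hS; exists (phi @` ngon (sides T) c v) => //.
  by exists (ngon (sides T) c v) => //; exists c, v.
move=> [_ [c' [v' [hc' hv' ->]]] e].
have [x Ax hx] : (h @` (phi @` ngon (sides T) c v)) (phi c').
  by rewrite -e; exists c' => //; apply: ngon_center; exact: sides_gt1.
have [y Ay hy] : (h @` (phi @` ngon (sides T) c v)) (phi (c' + w)).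
  by rewrite -e; exists (c' + w) => //; exact: hw.
have l1 : t%:C - (M * d)%:C <= `|phi c'|.
  rewrite -hx lerBlDr; apply: (@le_trans _ _ (`|h x| + `|h x - h 0|)).
    change (`|h 0| <= `|h x| + `|h x - h 0|).
    by rewrite -{1}[h 0](subKr (h x)); exact: ler_normB.
  by rewrite lerD2l hi subr0; exact: small.
have l2 : `|phi c'| * m%:C <= (2 * M * d)%:C.
  change (`|phi c'| * `|phi w - 1| <= (2 * M * d)%:C).
  rewrite -normrM mulrBr mulr1 -phiD -hx -hy hi; apply: (le_trans (ler_normB _ _)).
  rewrite -mulrA mulrDl mul1r rmorphD; apply: lerD; exact: small.
have l3 : (t - M * d) * m <= 2 * M * d.
  rewrite -lecR; apply: le_trans l2; rewrite rmorphM rmorphB.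
  by apply: ler_wpM2r => //; rewrite lecR ltW.
have d1 : d * (2 * M) <= t by rewrite -ler_pdivlMr ?mulr_gt0 // ge_min lexx.
have d2 : d * (5 * M) <= t * m by rewrite -ler_pdivlMr ?mulr_gt0 // ge_min lexx orbT.
have : d * (2 * M) * m <= t * m by rewrite ler_pM2r.
have Md : 0 < M * d by rewrite mulr_gt0.
lra.
Qed.

End FixZero.

Theorem corollary15 (R : realType) (T : regular_tiling) (alpha beta : R[i])
    (halpha : admissible T alpha)
    (hbeta : Zadj (xi R T) beta) (hbeta0 : beta != 0)
    (hcompat : compatible alpha (ideal_coloring T beta)) :
  (forall h : R[i] -> R[i], rot_tiles (S_ T alpha) h ->
     color_symmetry (Q_ T alpha)
       (image_coloring alpha (ideal_coloring T beta)) h)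
  /\
  (balanced (xi R T) alpha -> balanced (xi R T) beta ->
   forall h : R[i] -> R[i], sym_tiles (S_ T alpha) h ->
     color_symmetry (Q_ T alpha)
       (image_coloring alpha (ideal_coloring T beta)) h).
Proof.
have [a0 _ _] := halpha.
have direct h u : sym_tiles (S_ T alpha) h -> `|u| = 1 ->
    (forall z, h z = u * z) ->
    color_symmetry (Q_ T alpha) (image_coloring alpha (ideal_coloring T beta)) h.
  move=> hS /(unit_phi a0)[t ->] hz.
  apply: (color_symmetry_lift halpha (lattice_symmetry_id T beta) _ _ _ hS) => //.
  by move=> z; rewrite hz addrC phiD.
split=> [h [hS ho]|ba bb h hS].
  have [u u1 [hz|hz]] := isometry_fix0 hS.1 (sym_tiles_fix0 halpha hS).
    exact: direct hS u1 hz.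
  (* The triangle [0], [1], [i] detects that [z |-> u * conjc z] reverses orientation. *)
  have : 0 < signed_area 0 1 ('i%C : R[i]).
    by rewrite /signed_area; simpc; rewrite /= ltr01.
  move=> /ho; rewrite !hz /signed_area conjc0 conjc1 mulr0 mulr1 !subr0.
  rewrite mulrA [conjc u * u]mulrC conj_norm1 // mul1r /= oppr_gt0.
  by rewrite ltr10.
have [u u1 [hz|hz]] := isometry_fix0 hS.1 (sym_tiles_fix0 halpha hS).
  exact: direct hS u1 hz.
have [_ [ua [_ [va Zva uva]] ea]] := ba; have [_ [ub [Zub _] eb]] := bb.
have [t ut] := unit_phi a0 u1.
(* As [conjc alpha = ua * alpha], the quotient is the inverse of the unit [ua], so the lifted
   reflection preserves [Z[xi]]. *)
have ra : alpha / conjc alpha = va.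
  have ua0 : ua != 0 by apply: contra_eq_neq uva => ->; rewrite mul0r eq_sym oner_neq0.
  by rewrite ea invfM mulrCA divff // mulr1 -[RHS]mul1r -(mulVf ua0) -mulrA uva mulr1.
have hH : lattice_symmetry T beta (fun z => - va * conjc z).
  apply: lattice_symmetry_conj; first exact: ZadjN.
    by rewrite normrN; exact: unit_norm ea uva.
  by exists ub.
apply: (color_symmetry_lift halpha hH _ _ _ hS) => //.
by move=> z; rewrite hz conj_phi // ra ut addrC phiD.
Qed.
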